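(* Let $T>0$, $\lambda>0$, $\sigma\in(0,T]$ and $\gamma=e^{-\lambda\sigma}\in(0,1)$, and let $U,f,h$ satisfy the standing assumptions (A1)-(A5) listed in the context. Let $T_{\sigma,\lambda}$ be the one-step Bellman operator and $W_\lambda$ the discounted value function defined in the context, and let $\|\cdot\|_\infty$ denote the sup-norm on $[\sigma,T]\times\mathbb{R}^n$. Then $T_{\sigma,\lambda}$ is a $\gamma$-contraction in $\|\cdot\|_\infty$ on $[\sigma,T]\times\mathbb{R}^n$: for all bounded $\Psi_1,\Psi_2:[0,T]\times\mathbb{R}^n\to\mathbb{R}$, $$\|T_{\sigma,\lambda}\Psi_1-T_{\sigma,\lambda}\Psi_2\|_\infty\le\gamma\,\|\Psi_1-\Psi_2\|_\infty.$$ Consequently, if $\widehat W:[0,T]\times\mathbb{R}^n\to\mathbb{R}$ is bounded and $\|T_{\sigma,\lambda}\widehat W-\widehat W\|_\infty\le\varsigma$ for some $\varsigma\ge0$, then $$\|\widehat W-W_\lambda\|_\infty\le\frac{\varsigma}{1-\gamma}=\frac{\varsigma}{1-e^{-\lambda\sigma}}.$$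
   Context: Standing assumptions. (A1) $U\subset\mathbb{R}^m$ is nonempty and compact. (A2) There is $L_f>0$ with $\|f(x_1,u)-f(x_2,u)\|\le L_f\|x_1-x_2\|$ for all $x_1,x_2\in\mathbb{R}^n$, $u\in U$, where $f:\mathbb{R}^n\times U\to\mathbb{R}^n$. (A3) There is $M_f>0$ with $\|f(x,u)\|\le M_f$ for all $(x,u)\in\mathbb{R}^n\times U$. (A4) For each $x$, $u\mapsto f(x,u)$ is continuous on $U$. (A5) $h:[0,T]\times\mathbb{R}^n\times U\to\mathbb{R}$ is measurable and: (i) there is $L_h>0$ with $|h(t,x_1,u)-h(t,x_2,u)|\le L_h\|x_1-x_2\|$ for all $t,x_1,x_2,u$; (ii) there is $M_h>0$ with $|h(t,x,u)|\le M_h$ for all $(t,x,u)$; (iii) for each $(t,x)$, $u\mapsto h(t,x,u)$ is continuous on $U$; (iv) for every compact $K\subset\mathbb{R}^n$, $\lim_{\delta\to0^+}\sup_{t\in[0,T-\delta],\,x\in K,\,u\in U}|h(t+\delta,x,u)-h(t,x,u)|=0$. Value function (in time-to-go $\tau$). For $(\tau,x)\in[0,T]\times\mathbb{R}^n$, $$W_\lambda(\tau,x)=\inf_{u(\cdot)}\int_0^\tau e^{-\lambda r}\,h\big(T-\tau+r,\,y(r),\,u(r)\big)\,dr,$$ the infimum being over measurable $u:[0,\tau]\to U$, with $y'(r)=f(y(r),u(r))$ a.e., $y(0)=x$. Bellman operator. $\mathcal A_\sigma$ is the set of measurable $a:[0,\sigma]\to U$. For $a\in\mathcal A_\sigma$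 let $y$ solve $y'(r)=f(y(r),a(r))$, $y(0)=x$, and set $c(\tau,x,a)=\int_0^\sigma e^{-\lambda r}h(T-\tau+r,y(r),a(r))\,dr$. For bounded $\Psi:[0,T]\times\mathbb{R}^n\to\mathbb{R}$ and $(\tau,x)\in[\sigma,T]\times\mathbb{R}^n$, $$(T_{\sigma,\lambda}\Psi)(\tau,x)=\inf_{a\in\mathcal A_\sigma}\big\{c(\tau,x,a)+\gamma\,\Psi(\tau-\sigma,y(\sigma))\big\}.$$
   Formalization: The claim fails as stated; in the contraction bound the norm of Ψ1−Ψ2 is taken over [0,T]×R^n, and the residual bound additionally assumes |Ŵ−W_λ| ≤ ς/(1−γ) on [0,σ)×R^n. *)

(* Defs.v *)
From HB Require Import structures.
From mathcomp Require Import all_boot all_order all_algebra.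
From mathcomp Require Import all_classical all_reals all_analysis.

Set Implicit Arguments.
Unset Strict Implicit.
Unset Printing Implicit Defensive.

Import Order.TTheory GRing.Theory Num.Theory.
Import numFieldNormedType.Exports.

Local Open Scope classical_set_scope.
Local Open Scope ring_scope.

(* The library norm `|x| on 'rV[R]_n is the max-norm; it induces the same
   topology as this one. *)
Definition enorm (R : realType) (n : nat) (x : 'rV[R]_n) : R :=
  Num.sqrt (\sum_(i < n) x 0 i ^+ 2).

(* Extended-real valued, so that no boundedness is hidden in a default value.
   It is -oo on the empty set, hence only used with D nonempty. *)
Definition supnorm (R : realType) (X : Type) (D : set X) (F : X -> R) : \bar R :=
  ereal_sup [set (`|F p|)%:E | p in D].

Definition bounded_on (R : realType) (X : Type) (D : set X) (F : X -> R) : Prop :=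
  exists M : R, forall p, D p -> `|F p| <= M.

Definition abs_continuous_on (R : realType) (n : nat) (a b : R)
    (y : R -> 'rV[R]_n) : Prop :=
  forall e : R, 0 < e -> exists2 d : R, 0 < d &
    forall (N : nat) (s t : 'I_N -> R),
      (forall i, a <= s i /\ s i <= t i /\ t i <= b) ->
      trivIset setT (fun i => `]s i, t i[%classic) ->
      \sum_(i < N) (t i - s i) < d ->
      \sum_(i < N) enorm (y (t i) - y (s i)) < e.

(* The maps f and h are total; only their values at t in [0, T] and u in U are
   constrained here, and only those values are used below. *)
Record standing_assumptions (R : realType) (n m : nat) (T : R)
    (U : set 'rV[R]_m) (f : 'rV[R]_n -> 'rV[R]_m -> 'rV[R]_n)
    (h : R -> 'rV[R]_n -> 'rV[R]_m -> R) : Prop := StandingAssumptions {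
  control_set_nonempty : U !=set0 ;
  control_set_compact : compact U ;
  dynamics_lipschitz : exists2 Lf : R, 0 < Lf &
    forall x1 x2 u, U u -> enorm (f x1 u - f x2 u) <= Lf * enorm (x1 - x2) ;
  dynamics_bounded : exists2 Mf : R, 0 < Mf &
    forall x u, U u -> enorm (f x u) <= Mf ;
  dynamics_continuous : forall x, {within U, continuous (f x)} ;
  (* Borel sigma-algebras of the (product) topologies *)
  cost_measurable :
    measurable_fun
      ([set p | 0 <= p.1.1 <= T /\ U p.2]
        : set (g_sigma_algebraType (@open (R * 'rV[R]_n * 'rV[R]_m)%type)))
      (fun p => h p.1.1 p.1.2 p.2) ;
  cost_lipschitz : exists2 Lh : R, 0 < Lh &
    forall t x1 x2 u, 0 <= t <= T -> U u ->
      `|h t x1 u - h t x2 u| <= Lh * enorm (x1 - x2) ;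
  cost_bounded : exists2 Mh : R, 0 < Mh &
    forall t x u, 0 <= t <= T -> U u -> `|h t x u| <= Mh ;
  cost_continuous : forall t x, 0 <= t <= T -> {within U, continuous (h t x)} ;
  (* K is nonempty only because the supremum over the empty set is -oo here *)
  cost_time_equicontinuous : forall K : set 'rV[R]_n, compact K -> K !=set0 ->
    supnorm [set p : R * 'rV[R]_n * 'rV[R]_m |
               0 <= p.1.1 <= T - delta /\ K p.1.2 /\ U p.2]
            (fun p => h (p.1.1 + delta) p.1.2 p.2 - h p.1.1 p.1.2 p.2)
      @[delta --> 0^'+] --> 0%E
}.

Definition admissible_control (R : realType) (m : nat) (U : set 'rV[R]_m)
    (s : R) (u : R -> 'rV[R]_m) : Prop :=
  measurable_fun (`[0, s]%classic : set R)
    (u : R -> g_sigma_algebraType (@open 'rV[R]_m)) /\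
  (forall r, 0 <= r <= s -> U (u r)).

(* Solution in the sense of Caratheodory. The derivative is the two-sided one;
   the values of y outside [0, s] matter at most at the endpoints, which are
   negligible. *)
Definition trajectory (R : realType) (n m : nat)
    (f : 'rV[R]_n -> 'rV[R]_m -> 'rV[R]_n) (s : R) (x : 'rV[R]_n)
    (u : R -> 'rV[R]_m) (y : R -> 'rV[R]_n) : Prop :=
  [/\ y 0 = x,
      abs_continuous_on 0 s y &
      {ae (@lebesgue_measure R), forall r, 0 <= r <= s ->
        is_derive r 1 y (f (y r) (u r))}].

(* Discounted running cost over [0, s], for time-to-go tau at the start. *)
Definition running_cost (R : realType) (n m : nat)
    (h : R -> 'rV[R]_n -> 'rV[R]_m -> R) (T lam s tau : R)
    (y : R -> 'rV[R]_n) (u : R -> 'rV[R]_m) : R :=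
  (\int[@lebesgue_measure R]_(r in `[0, s])
     (expR (- (lam * r)) * h (T - tau + r) (y r) (u r)))%R.

(* Infima are taken over the pairs (control, associated trajectory); under the
   standing assumptions the trajectory is unique on [0, s]. *)
Definition value_function (R : realType) (n m : nat) (T : R)
    (U : set 'rV[R]_m) (f : 'rV[R]_n -> 'rV[R]_m -> 'rV[R]_n)
    (h : R -> 'rV[R]_n -> 'rV[R]_m -> R) (lam : R) (p : R * 'rV[R]_n) : R :=
  inf [set J | exists u y,
    [/\ admissible_control U p.1 u,
        trajectory f p.1 p.2 u y &
        J = running_cost h T lam p.1 p.1 y u]].

Definition bellman (R : realType) (n m : nat) (T : R)
    (U : set 'rV[R]_m) (f : 'rV[R]_n -> 'rV[R]_m -> 'rV[R]_n)
    (h : R -> 'rV[R]_n -> 'rV[R]_m -> R) (sigma lam : R)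
    (Psi : R * 'rV[R]_n -> R) (p : R * 'rV[R]_n) : R :=
  inf [set J | exists a y,
    [/\ admissible_control U sigma a,
        trajectory f sigma p.2 a y &
        J = running_cost h T lam sigma p.1 y a
            + expR (- (lam * sigma)) * Psi (p.1 - sigma, y sigma)]].

(* I x R^n *)
Definition slab (R : realType) (n : nat) (I : interval R) : set (R * 'rV[R]_n) :=
  [set p | p.1 \in I].

(* Main.v *)
Require Import Defs.
From HB Require Import structures.
From mathcomp Require Import all_boot all_order all_algebra.
From mathcomp Require Import all_classical all_reals all_analysis.
From mathcomp Require Import measurable_realfun.
From mathcomp Require Import ring lra.

Set Implicit Arguments.
Unset Strict Implicit.
Unset Printing Implicit Defensive.

Import Order.TTheory GRing.Theory Num.Theory.
Import numFieldNormedType.Exports.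

Local Open Scope classical_set_scope.
Local Open Scope ring_scope.

(* Two infima over the same controlled trajectories differ by at most the
   supremum of the differences of their objectives, so the Bellman operator is a
   gamma-contraction.  Splitting a trajectory at time sigma, and gluing two
   trajectories together there, shows that the value function W is a fixed point
   of the operator on [sigma, T] x R^n.  The error d of What on that slab then
   satisfies d <= vs + gamma * max (vs / (1 - gamma), d), whence the bound.

   The infimum defining W is meaningful only over a nonempty set, so the
   fixed-point identity needs a trajectory from every point; constant controls
   suffice, and for these Picard iteration on short intervals, followed by
   gluing, gives global existence.  Uniqueness plays no role. *)

(** * Norms and infima *)

Lemma enorm_ge0 (R : realType) (n : nat) (x : 'rV[R]_n) : 0 <= enorm x.
Proof. exact: sqrtr_ge0. Qed.

Lemma sqr_enorm (R : realType) (n : nat) (x : 'rV[R]_n) :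
  enorm x ^+ 2 = \sum_(i < n) x 0 i ^+ 2.
Proof. by rewrite sqr_sqrtr// sumr_ge0// => i _; rewrite sqr_ge0. Qed.

Lemma enorm_coord (R : realType) (n : nat) (x : 'rV[R]_n) i :
  `|x 0 i| <= enorm x.
Proof.
rewrite -ler_sqr ?nnegrE ?enorm_ge0// sqr_enorm (bigD1 i)//= real_normK ?num_real//.
by rewrite lerDl sumr_ge0// => j _; rewrite sqr_ge0.
Qed.

(** The library norm is the maximum of the absolute entries. The sign condition on [e] matters when
    [n = 0], where the right-hand side is vacuous. *)
Lemma rV_normr_leP (R : realType) (n : nat) (x : 'rV[R]_n) (e : R) : 0 <= e ->
  `|x| <= e <-> forall i, `|x 0 i| <= e.
Proof.
move=> e0; rewrite [`|x|]/Num.Def.normr/= mx_normrE; split => [+ i|xe].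
  by apply: le_trans; exact: (le_bigmax _ (fun ij => `|x ij.1 ij.2|) (0, i)).
by rewrite bigmax_le// => -[i j] _ /=; rewrite (ord1 i).
Qed.

Lemma normr_le_enorm (R : realType) (n : nat) (x : 'rV[R]_n) : `|x| <= enorm x.
Proof. by apply/rV_normr_leP => [|i]; [exact: enorm_ge0|exact: enorm_coord]. Qed.

Lemma enorm_le_normr (R : realType) (n : nat) (x : 'rV[R]_n) :
  enorm x <= n%:R * `|x|.
Proof.
rewrite -ler_sqr ?nnegrE ?enorm_ge0 ?mulr_ge0// sqr_enorm.
have xi i : x 0 i ^+ 2 <= `|x| ^+ 2.
  rewrite -[leLHS]real_normK ?num_real// lerXn2r ?nnegrE//.
  by move: i; exact/rV_normr_leP.
apply: (le_trans (ler_sum _ (fun i _ => xi i))).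
rewrite sumr_const card_ord -[leLHS]mulr_natl exprMn ler_wpM2r ?sqr_ge0//.
by rewrite -natrX ler_nat; case: (n) => // k; rewrite leq_pmulr.
Qed.

(** Coordinatewise [(a + b)^2 <= 2 (a^2 + b^2)] gives this weak triangle inequality without
    Cauchy-Schwarz; the factor 2 is harmless in epsilon-delta estimates. *)
Lemma enormD (R : realType) (n : nat) (x y : 'rV[R]_n) :
  enorm (x + y) <= 2 * (enorm x + enorm y).
Proof.
rewrite -ler_sqr ?nnegrE ?enorm_ge0 ?mulr_ge0 ?addr_ge0 ?enorm_ge0// sqr_enorm.
apply: (@le_trans _ _ (2 * (enorm x ^+ 2 + enorm y ^+ 2))).
  rewrite !sqr_enorm -big_split/= mulr_sumr ler_sum// => i _; rewrite mxE.
  have := sqr_ge0 (x 0 i - y 0 i); rewrite !expr2; nra.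
have := enorm_ge0 x; have := enorm_ge0 y; rewrite !expr2; nra.
Qed.

Lemma supnorm_leP (R : realType) (X : Type) (D : set X) (F : X -> R) (M : R) :
  (supnorm D F <= M%:E)%E <-> forall p, D p -> `|F p| <= M.
Proof.
split => [FM p Dp|FM].
  by rewrite -lee_fin (le_trans _ FM)//; apply: ereal_sup_ubound; exists p.
by apply: ge_ereal_sup => _ [p Dp <-]; rewrite lee_fin FM.
Qed.

Lemma supnorm_EFin (R : realType) (X : Type) (D : set X) (F : X -> R) :
  D !=set0 -> bounded_on D F -> exists M : R, supnorm D F = M%:E.
Proof.
move=> [p Dp] [M FM]; exists (fine (supnorm D F)); rewrite fineK// fin_numElt.
rewrite (lt_le_trans (ltNyr `|F p|))/=; last by apply: ereal_sup_ubound; exists p.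
by rewrite (@le_lt_trans _ _ M%:E) ?ltry//; exact/supnorm_leP.
Qed.

Lemma ler_dist_inf (R : realType) (X : Type) (P : set X) (F G : X -> R) (d : R) :
  0 <= d -> has_lbound (F @` P) -> has_lbound (G @` P) ->
  (forall x, P x -> `|F x - G x| <= d) ->
  `|inf (F @` P) - inf (G @` P)| <= d.
Proof.
move=> d0 lF lG FG.
(* On an empty [P] both infima are the same default value. *)
have [->|/set0P P0] := eqVneq P set0; first by rewrite !image_set0 subrr normr0.
have half (F' G' : X -> R) : has_lbound (F' @` P) ->
    (forall x, P x -> `|F' x - G' x| <= d) ->
    inf (F' @` P) <= inf (G' @` P) + d.
  move=> lF' FG'; rewrite -lerBlDr; apply: lb_le_inf; first exact: image_nonempty.
  move=> _ [x Px <-]; rewrite lerBlDr (@le_trans _ _ (F' x))//.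
    by apply: ge_inf => //; exists x.
  by rewrite -lerBlDl (le_trans (ler_norm _))// FG'.
rewrite ler_norml lerNl opprB !lerBlDl; apply/andP; split; apply: half => //.
by move=> x Px; rewrite distrC FG.
Qed.

(** * Lebesgue measure and translations *)

Lemma measurable_addl (R : realType) (s : R) :
  measurable_fun setT ((fun r => s + r) : R -> R).
Proof. by apply: measurable_funD => //; exact: measurable_cst. Qed.

Lemma preimage_addl_itv (R : realType) (s : R) (a b : bool) (x y : R) :
  (fun r => s + r) @^-1` [set` Interval (BSide a x) (BSide b y)] =
  [set` Interval (BSide a (x - s)) (BSide b (y - s))].
Proof.
apply/seteqP; split => r /=; rewrite !in_itv/=;
  by case: a b => -[]; rewrite /= ?lerBlDl ?ltrBlDl ?lerBrDl ?ltrBrDl.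
Qed.

(** The pushforward under the translation gives half-open intervals their length, and this
    determines Lebesgue measure. *)
Lemma lebesgue_measure_addl (R : realType) (s : R) (A : set R) : measurable A ->
  lebesgue_measure ((fun r => s + r) @^-1` A) = lebesgue_measure A.
Proof.
move=> mA.
rewrite -[LHS]/(pushforward lebesgue_measure
  ((fun r => s + r) : _ -> measurableTypeR R) A).
apply/esym/lebesgue_measure_unique => //=; first exact: measurable_addl.
move=> mf _ [[a b]] _ <-.
rewrite /pushforward preimage_addl_itv !lebesgue_measure_itv/= !lte_fin ltrD2r.
by case: ifP => // _; rewrite -!EFinB; congr EFin; ring.
Qed.

Lemma ae_addl (R : realType) (s : R) (P : R -> Prop) :
  {ae (@lebesgue_measure R), forall r, P r} ->
  {ae (@lebesgue_measure R), forall r, P (s + r)}.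
Proof.
move=> [N [mN N0 PN]]; exists ((fun r => s + r) @^-1` N); split.
- by rewrite -[X in measurable X]setTI; exact: measurable_addl.
- by rewrite -[RHS]N0; exact: lebesgue_measure_addl.
- by move=> r /= nP; exact: PN.
Qed.

Lemma ae_neq (R : realType) (s : R) :
  {ae (@lebesgue_measure R), forall r, r != s}.
Proof.
exists [set s]; split => //; first exact: lebesgue_measure_set1.
by move=> r /=; case: eqVneq.
Qed.

(** For nonnegative integrands this is integration against the pushforward measure, which equals
    Lebesgue measure. The positive and negative parts of [g] are then treated separately. *)
Lemma Rintegral_addl (R : realType) (s : R) (D : set R) (g : R -> R) :
  measurable D -> measurable_fun D g ->
  \int[@lebesgue_measure R]_(r in D) g r =
  \int[@lebesgue_measure R]_(r in (fun r => s + r) @^-1` D) g (s + r).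
Proof.
move=> mD mg.
have ge0 (k : R -> \bar R) : measurable_fun D k -> (forall r, (0 <= k r)%E) ->
    (\int[@lebesgue_measure R]_(r in D) k r =
     \int[@lebesgue_measure R]_(r in (fun r => (s + r)%R) @^-1` D) k (s + r)%R)%E.
  move=> mk k0.
  transitivity (\int[pushforward (@lebesgue_measure R)
      ((fun r => (s + r)%R) : _ -> measurableTypeR R)]_(r in D) k r)%E.
    apply: eq_measure_integral => //=; first exact: measurable_addl.
    by move=> mf A mA _; exact/esym/lebesgue_measure_addl.
  by rewrite ge0_integral_pushforward//; exact: measurable_addl.
have mg' : measurable_fun D (EFin \o g) by exact/measurable_EFinP.
rewrite /Rintegral; congr fine; rewrite integralE [RHS]integralE.
congr (_ - _)%E.
- rewrite [LHS](ge0 (EFin \o g)^\+%E); last 2 first.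
  + exact: measurable_funepos.
  + exact: funepos_ge0.
  by apply: eq_integral => r _; rewrite ?funeposE ?funenegE.
- rewrite [LHS](ge0 (EFin \o g)^\-%E); last 2 first.
  + exact: measurable_funeneg.
  + exact: funeneg_ge0.
  by apply: eq_integral => r _; rewrite ?funeposE ?funenegE.
Qed.

Lemma norm_Rintegral_le (R : realType) (D : set R) (g : R -> R) (M : R) :
  measurable D -> (lebesgue_measure D < +oo)%E ->
  (@lebesgue_measure R).-integrable D (EFin \o g) -> (forall r, D r -> `|g r| <= M) ->
  `|\int[@lebesgue_measure R]_(r in D) g r| <= M * fine (lebesgue_measure D).
Proof.
move=> mD Doo ig gM; apply: le_trans (le_normr_Rintegral _ ig) _ => //.
rewrite -Rintegral_cst//; apply: le_Rintegral => //.
- exact: (integrable_norm ig).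
- by apply: measurable_bounded_integrable => //; exact: bounded_cst.
Qed.

(** * Joint Borel measurability *)

(* A space with a countable dense set has a countable base of balls. *)
Lemma measurable_preimage_open d (T : measurableType d) (R : realType)
    (X : pseudoMetricType R) (I : countType) (q : I -> X) (D : set T) (g : T -> X) :
  (forall x (e : R), 0 < e -> exists i, ball x e (q i)) ->
  (forall x (e : R), 0 < e -> measurable (D `&` g @^-1` ball x e)) ->
  forall O : set X, open O -> measurable (D `&` g @^-1` O).
Proof.
move=> denseq mball O oO.
pose B (ik : I * nat) := ball (q ik.1) (ik.2.+1%:R^-1 : R).
(* Balls not contained in [O] are replaced by the empty set, so that the union runs over a whole
   countable type. *)
pose F ik := D `&` g @^-1` (if `[< B ik `<=` O >] then B ik else set0).
rewrite (_ : _ `&` _ = \bigcup_ik F ik); last first.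
  apply/seteqP; split => [t [Dt Ogt]|t [ik _ []]]; last first.
    by case: asboolP => [BO Dt /BO|].
  have /nbhs_ballP[e /= e0 eO] : nbhs (g t) O by exact: open_nbhs_nbhs.
  (* With such a radius, [g t] and every point of the chosen ball lie within [e / 2] of its
     centre. *)
  have [k ke] : exists k, (k.+1%:R^-1 : R) < e / 2.
    have e20 : 0 < e / 2 by rewrite divr_gt0.
    have [k _ /(_ _ (leqnn k))] := near_infty_natSinv_lt (PosNum e20).
    by exists k.
  have k0 : 0 < (k.+1%:R^-1 : R) by rewrite invr_gt0.
  have [i qi] := denseq (g t) _ k0.
  exists (i, k) => //; split => //.
  case: asboolP => [_|]; first exact: ball_sym.
  case; move=> z Bz; apply: eO; rewrite /= (splitr e).
  by apply: (ball_triangle (le_ball (ltW ke) qi)); exact: le_ball (ltW ke) _ Bz.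
apply: countable_bigcupT_measurable => [|[i k]]; first exact: countableP.
rewrite /F; case: asboolP => _; first by apply: mball; rewrite invr_gt0.
by rewrite preimage_set0 setI0; exact: measurable0.
Qed.

Lemma dense_rat_rV (R : realType) (n : nat) (x : 'rV[R]_n) (e : R) : 0 < e ->
  exists q : 'rV[rat]_n, ball x e (map_mx ratr q : 'rV[R]_n).
Proof.
move=> e0.
have /choice[q qP] (i : 'I_n) :
    exists q : rat, (ratr q : R) \in `](x 0 i - e), (x 0 i + e)[.
  by apply: rat_in_itvoo; lra.
exists (\row_i q i); split => // i j; rewrite (ord1 i) !mxE -ball_normE/=.
have := qP j; rewrite in_itv/= => /andP[? ?].
by rewrite ltr_distlC; apply/andP; split.
Qed.

(** Measurability of [h] refers to the Borel sets of the product topology. Balls of the product are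
    products of balls, so componentwise measurability handles them, and rational points supply the
    countable dense set. *)
Lemma measurable_fun_borel_triple d (T : measurableType d) (R : realType)
    (n m : nat) (D : set T) (g1 : T -> R) (g2 : T -> 'rV[R]_n) (g3 : T -> 'rV[R]_m) :
  measurable D -> measurable_fun D g1 ->
  measurable_fun D (g2 : T -> g_sigma_algebraType (@open 'rV[R]_n)) ->
  measurable_fun D (g3 : T -> g_sigma_algebraType (@open 'rV[R]_m)) ->
  measurable_fun D ((fun t => (g1 t, g2 t, g3 t)) :
    T -> g_sigma_algebraType (@open (R * 'rV[R]_n * 'rV[R]_m)%type)).
Proof.
move=> mD mg1 mg2 mg3.
pose G := @open (R * 'rV[R]_n * 'rV[R]_m)%type.
apply: (@measurability _ _ T (g_sigma_algebraType G) D
  (fun t => (g1 t, g2 t, g3 t)) G) => // _ [V oV <-].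
move: V oV; apply: (@measurable_preimage_open _ _ R (R * 'rV[R]_n * 'rV[R]_m)%type
  (rat * 'rV[rat]_n * 'rV[rat]_m)%type
  (fun q => (ratr q.1.1, map_mx ratr q.1.2, map_mx ratr q.2)) D
  (fun t => (g1 t, g2 t, g3 t))).
  move=> [[a b] c] e e0.
  have [q] := rat_in_itvoo (ltr_pwDr e0 (lexx (a - e)) : a - e < a - e + e).
  have [qb bq] := dense_rat_rV b e0; have [qc cq] := dense_rat_rV c e0.
  rewrite subrK in_itv/= => /andP[eq qa]; exists (q, qb, qc); split => //; split => //=.
  by rewrite -ball_normE/= ltr_distlC eq (lt_trans qa)// ltrDl.
move=> [[a b] c] e e0.
rewrite (_ : _ `&` _ = (D `&` g1 @^-1` ball a e) `&` (D `&` g2 @^-1` ball b e) `&`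
    (D `&` g3 @^-1` ball c e)); last first.
  apply/seteqP; split => [t [Dt [[b1 b2] b3]]|t [[[Dt b1] [_ b2]] [_ b3]]].
    exact: (conj (conj (conj Dt b1) (conj Dt b2)) (conj Dt b3)).
  exact: (conj Dt (conj (conj b1 b2) b3)).
apply: measurableI; first apply: measurableI.
- by apply: mg1 => //; apply: open_measurable; exact: ball_open.
- by apply: mg2 => //; apply: sub_sigma_algebra; exact: ball_open.
- by apply: mg3 => //; apply: sub_sigma_algebra; exact: ball_open.
Qed.

(** * Trajectories *)

Definition concat (R : realType) (V : Type) (c : R) (g1 g2 : R -> V) (r : R) : V :=
  if r < c then g1 r else g2 (r - c).

Lemma is_derive_addl (R : realType) (n : nat) (y : R -> 'rV[R]_n) (s r : R) df :
  is_derive (s + r) 1 y df -> is_derive r 1 (fun t => y (s + t)) df.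
Proof.
have E : (fun h : R => h^-1 *: (((fun t => y (s + t)) \o shift r) (h *: 1) - y (s + r)))
    = (fun h : R => h^-1 *: ((y \o shift (s + r)) (h *: 1) - y (s + r))).
  by apply/funext => h; congr (_ *: (y _ - _)); rewrite /shift/= addrCA.
by case=> d e; split; rewrite /derivable ?E// -e /derive E.
Qed.

(** * Absolutely continuous curves under restriction, time shift and gluing *)

Section abs_continuity.
Context (R : realType) (n : nat).
Implicit Types (a b c : R) (y : R -> 'rV[R]_n).

Lemma abs_continuous_onS a b a' b' y : a <= a' -> b' <= b ->
  abs_continuous_on a b y -> abs_continuous_on a' b' y.
Proof.
move=> aa' b'b yab e /yab[d d0 H]; exists d => // N s t st.
by apply: H => i; have [? [? ?]] := st i; do !split; lra.
Qed.

Lemma abs_continuous_on_addl a b c y : abs_continuous_on (c + a) (c + b) y ->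
  abs_continuous_on a b (fun r => y (c + r)).
Proof.
move=> yab e /yab[d d0 H]; exists d => // N s t st tI sd.
apply: (H N (fun i => c + s i) (fun i => c + t i)).
- by move=> i; have [? [? ?]] := st i; do !split; lra.
- move=> i j _ _ [r [/= ri rj]]; apply: tI => //; exists (r - c).
  move: ri rj; rewrite /= !in_itv/= => /andP[? ?] /andP[? ?].
  by split; apply/andP; split; lra.
- apply: le_lt_trans sd; rewrite le_eqVlt; apply/orP; left; apply/eqP.
  by apply: eq_bigr => i _; ring.
Qed.

Lemma abs_continuous_on_continuous a b y : abs_continuous_on a b y ->
  {within `[a, b], continuous y}.
Proof.
move=> yab; apply/subspace_continuousP => x; rewrite /= in_itv/= => /andP[ax xb].
apply/cvgrPdist_lt => e e0; have [d d0 H] := yab _ e0.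
have key (s t : R) : a <= s -> s <= t -> t <= b -> t - s < d -> enorm (y t - y s) < e.
  move=> as_ st tb std.
  (* A family of one interval turns absolute continuity into uniform continuity. *)
  have := H 1%N (fun=> s) (fun=> t); rewrite !big_ord1; apply => // i j _ _ _.
  by rewrite (ord1 i) (ord1 j).
have enormN (z : 'rV[R]_n) : enorm (- z) = enorm z.
  by rewrite /enorm; congr Num.sqrt; apply: eq_bigr => i _; rewrite mxE sqrrN.
rewrite near_withinE; near=> r; rewrite /= in_itv/= => /andP[ar rb].
have : `|x - r| < d by near: r; exact: (@cvgr_dist_lt _ _ _ _ _ _ x).
rewrite ltr_distlC => /andP[? ?]; apply: le_lt_trans (normr_le_enorm _) _.
by have [xr|rx] := leP x r; [rewrite -enormN opprB|]; apply: key => //; lra.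
Unshelve. all: by end_near. Qed.

(* [y r = y1 (min r c) + y2 (max r c - c) - y2 0], so that the increments of [y]
   split into increments of [y1] and of [y2] even across the junction. *)
Lemma abs_continuous_on_concat c l y1 y2 : 0 <= c -> 0 <= l -> y2 0 = y1 c ->
  abs_continuous_on 0 c y1 -> abs_continuous_on 0 l y2 ->
  abs_continuous_on 0 (c + l) (concat c y1 y2).
Proof.
move=> c0 l0 y2y1 y1c y2l e e0.
(* Two pieces and the factor 2 of [enormD] add up to [2 (e/4 + e/4) = e]. *)
have e40 : 0 < e / 4 by rewrite divr_gt0.
have [d1 d10 H1] := y1c _ e40; have [d2 d20 H2] := y2l _ e40.
exists (Num.min d1 d2); first by rewrite lt_min d10.
move=> N s t st tI; rewrite lt_min => /andP[sd1 sd2].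
have yE r : concat c y1 y2 r = y1 (Num.min r c) + (y2 (Num.max r c - c) - y2 0).
  rewrite /concat; case: (ltP r c) => _; first by rewrite subrr subrr addr0.
  by rewrite -y2y1 [RHS]addrC subrK.
have {}H1 : \sum_(i < N) enorm (y1 (Num.min (t i) c) - y1 (Num.min (s i) c)) < e / 4.
  apply: (H1 N (fun i => Num.min (s i) c) (fun i => Num.min (t i) c)).
  - move=> i; have [? [? ?]] := st i.
    by do !split; case: (lerP (s i) c) => ?; case: (lerP (t i) c) => ?; lra.
  - move=> i j _ _ [r [/=]]; rewrite !in_itv/= !lt_min !gt_min.
    (* A point of a truncated interval lies below [c], hence in the original interval, so
       disjointness carries over. *)
    case/andP=> /orP[sir|cr] /andP[? rc]; last by have := lt_trans cr rc; rewrite ltxx.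
    case/andP=> /orP[sjr|cr] /andP[? _]; last by have := lt_trans cr rc; rewrite ltxx.
    by apply: tI => //; exists r; split; rewrite /= in_itv/=; apply/andP; split.
  - apply: le_lt_trans sd1; apply: ler_sum => i _; have [? [? ?]] := st i.
    by case: (lerP (s i) c) => ?; case: (lerP (t i) c) => ?; lra.
have {}H2 : \sum_(i < N)
    enorm (y2 (Num.max (t i) c - c) - y2 (Num.max (s i) c - c)) < e / 4.
  apply: (H2 N (fun i => Num.max (s i) c - c) (fun i => Num.max (t i) c - c)).
  - move=> i; have [? [? ?]] := st i.
    by do !split; case: (lerP (s i) c) => ?; case: (lerP (t i) c) => ?; lra.
  - move=> i j _ _ [r [/=]]; rewrite !in_itv/= !ltrBlDr !ltrBrDr !gt_max !lt_max.
    case/andP=> /andP[? cr] /orP[?|rc]; last by have := lt_trans cr rc; rewrite ltxx.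
    case/andP=> /andP[? _] /orP[?|rc]; last by have := lt_trans cr rc; rewrite ltxx.
    by apply: tI => //; exists (r + c); split; rewrite /= in_itv/=; apply/andP; split.
  - apply: le_lt_trans sd2; apply: ler_sum => i _; have [? [? ?]] := st i.
    by case: (lerP (s i) c) => ?; case: (lerP (t i) c) => ?; lra.
apply: (@le_lt_trans _ _ (\sum_(i < N)
   2 * (enorm (y1 (Num.min (t i) c) - y1 (Num.min (s i) c)) +
        enorm (y2 (Num.max (t i) c - c) - y2 (Num.max (s i) c - c))))).
  apply: ler_sum => i _; rewrite !yE; apply: le_trans (enormD _ _).
  rewrite le_eqVlt; apply/orP; left; apply/eqP; congr enorm.
  by rewrite opprD addrACA opprB [_ - y2 0 + _]addrA subrK.
rewrite -mulr_sumr big_split/=; lra.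
Qed.

End abs_continuity.

(** * Controls and trajectories under restriction, time shift and gluing *)

Section trajectories.
Context (R : realType) (n m : nat) (U : set 'rV[R]_m).
Context (f : 'rV[R]_n -> 'rV[R]_m -> 'rV[R]_n).
Implicit Types (s l : R) (x : 'rV[R]_n) (u : R -> 'rV[R]_m) (y : R -> 'rV[R]_n).

Lemma admissible_controlS s l u : s <= l ->
  admissible_control U l u -> admissible_control U s u.
Proof.
move=> sl [mu Uu]; split; last by move=> r r0s; apply: Uu; lra.
by apply: measurable_funS mu => //; apply: subset_itvl; rewrite bnd_simp.
Qed.

Lemma admissible_control_addl s l u : 0 <= s ->
  admissible_control U (s + l) u -> admissible_control U l (fun r => u (s + r)).
Proof.
move=> s0 [mu Uu]; split; last by move=> r r0s; apply: Uu; lra.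
apply: (@measurable_comp _ _ _ _ _ _ `[0, s + l]%classic) => //.
- move=> _ [r + <-]; rewrite /= !in_itv/= => /andP[? ?]; apply/andP; split; lra.
- exact: measurable_funTS (measurable_addl s).
Qed.

Lemma admissible_control_concat s l u1 u2 : 0 <= s -> 0 <= l ->
  admissible_control U s u1 -> admissible_control U l u2 ->
  admissible_control U (s + l) (concat s u1 u2).
Proof.
move=> s0 l0 [mu1 Uu1] [mu2 Uu2]; split; last first.
  by move=> r r0s; rewrite /concat; case: (ltP r s) => ?; [apply: Uu1|apply: Uu2]; lra.
rewrite (_ : `[0, s + l]%classic = `[0, s[%classic `|` `[s, s + l]%classic); last first.
  apply/seteqP; split => r /=; rewrite !in_itv/=.
    move=> /andP[r0 rl]; have [rs|sr] := ltP r s; [left|right];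
      apply/andP; split; lra.
  by move=> [|] /andP[? ?]; apply/andP; split; lra.
apply/measurable_funU => //; split.
  apply: (@eq_measurable_fun _ _ _ _ _ (u1 : R -> g_sigma_algebraType open)).
    by move=> r; rewrite inE/= in_itv/= /concat => /andP[_ ->].
  by apply: measurable_funS mu1 => //; apply: subset_itvl; rewrite bnd_simp.
apply: (@eq_measurable_fun _ _ _ _ _
    ((u2 : R -> g_sigma_algebraType open) \o (fun r => - s + r))).
  by move=> r; rewrite inE/= in_itv/= /concat [- s + r]addrC => /andP[]; case: ltP.
apply: (@measurable_comp _ _ _ _ _ _ `[0, l]%classic) => //.
- move=> _ [r + <-]; rewrite /= !in_itv/= => /andP[? ?]; apply/andP; split; lra.
- exact: measurable_funTS (measurable_addl (- s)).
Qed.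

Lemma trajectoryS s l x u y : s <= l ->
  trajectory f l x u y -> trajectory f s x u y.
Proof.
move=> sl [y0 yac dy]; split => //; first exact: abs_continuous_onS yac.
move: dy; apply: filterS; first exact: (ae_filter_ringOfSetsType (@lebesgue_measure R)).
by move=> r dy r0s; apply: dy; lra.
Qed.

Lemma trajectory_addl s l x u y : 0 <= s -> trajectory f (s + l) x u y ->
  trajectory f l (y s) (fun r => u (s + r)) (fun r => y (s + r)).
Proof.
move=> s0 [y0 yac dy]; split; first by rewrite addr0.
- by apply: abs_continuous_on_addl; rewrite addr0; exact: abs_continuous_onS yac.
- move: (ae_addl s dy); apply: filterS.
    exact: (ae_filter_ringOfSetsType (@lebesgue_measure R)).
  by move=> r {}dy r0l; apply: is_derive_addl; apply: dy; lra.
Qed.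

(** Away from [s] the glued curve coincides locally with one of the pieces and inherits its
    derivative. At [s] the two-sided derivative may fail to exist, but a single point is null. *)
Lemma trajectory_concat s l x u1 u2 y1 y2 : 0 <= s -> 0 <= l ->
  trajectory f s x u1 y1 -> trajectory f l (y1 s) u2 y2 ->
  trajectory f (s + l) x (concat s u1 u2) (concat s y1 y2).
Proof.
move=> s0 l0 [y10 yac1 dy1] [y20 yac2 dy2]; split.
- rewrite /concat; case: ltP => // ?; have s00 : s = 0 by lra.
  by rewrite s00 subrr y20 s00.
- by apply: abs_continuous_on_concat.
move: (ae_neq s) dy1 (ae_addl (- s) dy2); apply: filterS3.
  exact: (ae_filter_ringOfSetsType (@lebesgue_measure R)).
move=> r rs dy1 {}dy2 r0l.
have [{}rs|sr] := ltP r s.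
  have near_y : \near r, y1 r = concat s y1 y2 r.
    by near=> t; rewrite /concat ifT//; near: t; exact: lt_nbhsl.
  have -> : concat s y1 y2 r = y1 r by rewrite /concat rs.
  have -> : concat s u1 u2 r = u1 r by rewrite /concat rs.
  by apply: near_eq_is_derive near_y _; apply: dy1; lra.
have {}sr : s < r by rewrite lt_neqAle eq_sym rs.
have near_y : \near r, y2 (- s + r) = concat s y1 y2 r.
  near=> t; rewrite /concat ifF 1?addrC//; apply/negbTE; rewrite -leNgt ltW//.
  by near: t; exact: lt_nbhsr.
have -> : concat s y1 y2 r = y2 (- s + r) by rewrite /concat ltNge ltW//= addrC.
have -> : concat s u1 u2 r = u2 (- s + r) by rewrite /concat ltNge ltW//= addrC.
by apply: near_eq_is_derive near_y _; apply: is_derive_addl; apply: dy2; lra.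
Unshelve. all: by end_near. Qed.

End trajectories.

(** * Running cost *)

Section running_cost.
Context (R : realType) (n m : nat) (T lam : R) (U : set 'rV[R]_m).
Context (f : 'rV[R]_n -> 'rV[R]_m -> 'rV[R]_n) (h : R -> 'rV[R]_n -> 'rV[R]_m -> R).
Hypotheses (lam_gt0 : 0 < lam) (HA : standing_assumptions T U f h).
Implicit Types (s tau : R) (x : 'rV[R]_n) (u : R -> 'rV[R]_m) (y : R -> 'rV[R]_n).

Local Notation discounted tau y u :=
  (fun r => expR (- (lam * r)) * h (T - tau + r) (y r) (u r)).

Lemma trajectory_measurable s x u y : trajectory f s x u y ->
  measurable_fun `[0, s] (y : R -> g_sigma_algebraType (@open 'rV[R]_n)).
Proof.
move=> [_ /abs_continuous_on_continuous yc _].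
apply: (@measurability _ _ _ (g_sigma_algebraType (@open 'rV[R]_n)) `[0, s]%classic
  y (@open 'rV[R]_n)) => // _ [V oV <-].
apply: open_measurable_subspace; first exact: measurable_itv.
by move/continuousP : yc; exact.
Qed.

Lemma discounted_measurable s tau x u y : s <= tau -> tau <= T ->
  admissible_control U s u -> trajectory f s x u y ->
  measurable_fun `[0, s] (discounted tau y u).
Proof.
move=> stau tauT [mu Uu] /trajectory_measurable my.
apply: measurable_funM.
  apply: measurableT_comp; first exact: measurable_expR.
  by apply: measurableT_comp => //; exact: measurable_funM.
pose D := [set p : R * 'rV[R]_n * 'rV[R]_m | 0 <= p.1.1 <= T /\ U p.2].
pose g := fun r => (T - tau + r, y r, u r).
rewrite (_ : (fun r => _) = (fun p => h p.1.1 p.1.2 p.2) \o g)//.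
apply: (measurable_comp (F := D : set (g_sigma_algebraType open))).
(* [D] is Borel because it is closed, [U] being compact in a Hausdorff space. *)
- have cU : closed U.
    by apply: compact_closed (control_set_compact HA); exact: norm_hausdorff.
  have cD : closed D.
    apply: closedI; last by apply: closed_comp cU => p _; exact: cvg_snd.
    apply: (@closed_comp _ _ (fun p => p.1.1) `[0, T]%classic).
      by move=> p _; apply: continuous_comp; exact: cvg_fst.
    exact: interval_closed.
  rewrite -[D]setCK; apply: measurableC; apply: sub_sigma_algebra.
  exact: closed_openC.
- move=> _ [r + <-]; rewrite /= in_itv/= => r0s; split; last exact: Uu.
  by move/andP: r0s => [? ?]; apply/andP; split => /=; lra.
- exact: (cost_measurable HA).
- apply: measurable_fun_borel_triple => //.
  exact: measurable_funTS (measurable_addl _).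
Qed.

Lemma discounted_bound : exists2 M, 0 < M & forall s tau u y r,
  s <= tau -> tau <= T -> admissible_control U s u -> r \in `[0, s] ->
  `|discounted tau y u r| <= M.
Proof.
have [M M0 hM] := cost_bounded HA; exists M => // s tau u y r stau tauT [_ Uu].
rewrite in_itv/= => /andP[r0 rs]; rewrite normrM ger0_norm ?expR_ge0//.
rewrite -[leRHS]mul1r; apply: ler_pM => //.
  by rewrite -expR0 ler_expR oppr_le0 mulr_ge0// ltW.
by apply: hM; [apply/andP; split; lra|apply: Uu; rewrite r0].
Qed.

Lemma discounted_integrable s tau x u y : s <= tau -> tau <= T ->
  admissible_control U s u -> trajectory f s x u y ->
  (@lebesgue_measure R).-integrable `[0, s] (EFin \o discounted tau y u).
Proof.
move=> stau tauT uad ytr; apply: measurable_bounded_integrable => //.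
- by apply: compact_finite_measure; exact: segment_compact.
- exact: discounted_measurable ytr.
- have [M _ hM] := discounted_bound; exists M; split; first exact: num_real.
  move=> N MN r /= r0s; apply: le_trans (ltW MN).
  exact: (hM s tau u y r).
Qed.

(** One constant serves all controls and trajectories. It bounds the sets of costs below, so that
    their [inf] is a genuine infimum and not a default value. *)
Lemma running_cost_bound : exists M, forall s tau x u y,
  0 <= s -> s <= tau -> tau <= T ->
  admissible_control U s u -> trajectory f s x u y ->
  `|running_cost h T lam s tau y u| <= M.
Proof.
have [M M0 hM] := discounted_bound; exists (M * T).
move=> s tau x u y s0 stau tauT uad ytr.
have ig := discounted_integrable stau tauT uad ytr.
have mus : fine (@lebesgue_measure R `[0, s]%classic) <= T.
  by rewrite lebesgue_measure_itv/=; case: ifP => _ /=; lra.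
apply: le_trans (norm_Rintegral_le (M := M) _ _ ig _) _ => //.
- by apply: compact_finite_measure; exact: segment_compact.
- by move=> r r0s; apply: (hM s tau u y r).
- by rewrite ler_pM2l.
Qed.

(** Substituting [s + r] for [r] in the tail pulls out the discount [expR (- (lam * s))], and the
    clock matches because [T - tau + (s + r) = T - l + r]. *)
Lemma running_cost_split s l tau x u y : 0 <= s -> 0 <= l -> s + l = tau -> tau <= T ->
  admissible_control U tau u -> trajectory f tau x u y ->
  running_cost h T lam tau tau y u = running_cost h T lam s tau y u +
    expR (- (lam * s)) *
    running_cost h T lam l l (fun r => y (s + r)) (fun r => u (s + r)).
Proof.
move=> s0 l0 sl tauT uad ytr.
have ig := discounted_integrable (lexx _) tauT uad ytr.
have slt : s <= tau by lra.
rewrite /running_cost.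
have := Rintegral_itvB ig (x := s); rewrite !bnd_simp => /(_ s0 slt).
move=> /(canRL (subrK _)) ->; rewrite addrC; congr (_ + _).
(* The difference of integrals is over a half-open interval; its left endpoint is restored at no
   cost. *)
rewrite Rintegral_itv_obnd_cbnd; last first.
  by apply: integrableS ig => //; apply: subset_itvr; rewrite bnd_simp.
rewrite (Rintegral_addl s)//; last first.
  apply: measurable_funS (discounted_measurable (lexx _) tauT uad ytr) => //.
  by apply: subset_itvr; rewrite bnd_simp.
rewrite preimage_addl_itv subrr (_ : tau - s = l); last lra.
rewrite -RintegralZl//; last first.
  have ltau : l <= T by lra.
  apply: (discounted_integrable (lexx _) ltau (x := y s)).
    by apply: admissible_control_addl; rewrite ?sl.
  by apply: (@trajectory_addl _ _ _ f s l x u y s0); rewrite sl.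
apply: eq_Rintegral => r _; rewrite mulrA -expRD; congr (expR _ * h _ _ _).
  by rewrite mulrDr opprD.
by rewrite -sl; ring.
Qed.

(** Endpoints are null. Agreement is asked for on the open interval only, since a glued control
    takes the second control's value at the junction. *)
Lemma running_cost_eq s tau x x' u u' y y' : 0 <= s -> s <= tau -> tau <= T ->
  admissible_control U s u -> trajectory f s x u y ->
  admissible_control U s u' -> trajectory f s x' u' y' ->
  (forall r, 0 < r < s -> y r = y' r /\ u r = u' r) ->
  running_cost h T lam s tau y u = running_cost h T lam s tau y' u'.
Proof.
move=> s0 stau tauT uad ytr uad' ytr' E.
have oo v z w : admissible_control U s v -> trajectory f s w v z ->
    running_cost h T lam s tau z v =
    \int[@lebesgue_measure R]_(r in `]0, s[) discounted tau z v r.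
  move=> vad ztr; have ig := discounted_integrable stau tauT vad ztr.
  rewrite Rintegral_itv_bndo_bndc ?Rintegral_itv_obnd_cbnd//.
  - apply: integrableS ig => //; apply: subset_itvr; by rewrite bnd_simp.
  - by apply: integrableS ig => //; apply: subset_itv; rewrite bnd_simp.
rewrite (oo _ _ _ uad ytr) (oo _ _ _ uad' ytr').
by apply: eq_Rintegral => r; rewrite inE/= in_itv/= => /E[-> ->].
Qed.

End running_cost.

(** * Existence of trajectories for constant controls *)

Lemma dyadic_small (R : realType) (c e : R) : 0 < e ->
  \forall k \near \oo, c * 2^-1 ^+ k < e.
Proof.
move=> e0; have c0 : geometric c (2^-1 : R) @ \oo --> 0.
  by apply: cvg_geometric; rewrite ger0_norm; lra.
move/cvgrPdist_lt : c0 => /(_ _ e0); apply: filterS => k; rewrite sub0r normrN.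
exact: le_lt_trans (ler_norm _).
Qed.

(** Used to pass to the limit in estimates on Picard iterates, whose errors halve at each step. *)
Lemma ler_dyadic (R : realType) (a b c : R) :
  (forall k, a <= b + c * 2^-1 ^+ k) -> a <= b.
Proof.
move=> abc; apply/ler_addgt0Pr => e e0.
have [k _ /(_ _ (leqnn k)) ke] := dyadic_small c e0.
by apply: le_trans (abc k) _; rewrite lerD2l ltW.
Qed.

Lemma lipschitz_continuous (R : realType) (V : normedModType R) (K : R) (g : R -> V) :
  (forall r s, `|g r - g s| <= K * `|r - s|) -> continuous g.
Proof.
move=> gK r; apply/cvgrPdist_le => e e0; near=> s.
(* The constant [|K| + 1] is positive whatever the sign of [K], so one can divide by it. *)
apply: le_trans (gK r s) _; apply: (@le_trans _ _ ((`|K| + 1) * `|r - s|)).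
  by rewrite ler_wpM2r// (le_trans (ler_norm _))// lerDl.
rewrite -ler_pdivlMl ?ltr_pwDr//; near: s.
by apply: cvgr_dist_le; [exact: cvg_id|rewrite mulr_gt0// invr_gt0 ltr_pwDr].
Unshelve. all: by end_near. Qed.

(** * Picard iteration on a short interval for a bounded Lipschitz autonomous field *)

Section picard.
Context (R : realType) (n : nat) (F : 'rV[R]_n -> 'rV[R]_n) (L M d : R) (x : 'rV[R]_n).
Hypotheses (L0 : 0 <= L) (M0 : 0 <= M) (d0 : 0 < d) (Ld : L * d <= 2^-1).
Hypothesis FL : forall a b, `|F a - F b| <= L * `|a - b|.
Hypothesis FM : forall a, `|F a| <= M.
Implicit Types (y z : R -> 'rV[R]_n) (t r : R).

Let clamp t := Num.max 0 (Num.min t d).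

Let clampP t : 0 <= clamp t <= d.
Proof. by rewrite /clamp le_max lexx/= ge_max ltW//= ge_min lexx orbT. Qed.

Let clampE t : 0 <= t <= d -> clamp t = t.
Proof. by move=> /andP[t0 td]; rewrite /clamp (min_idPl td) (max_idPr t0). Qed.

Let clamp_le t r : t <= r -> clamp t <= clamp r.
Proof.
by rewrite /clamp; case: (leP t d) => ?; case: (leP r d) => ?;
  case: (leP 0 t) => ?; case: (leP 0 r) => ?; case: (leP 0 d) => ?; lra.
Qed.

Let dist_clamp t r : `|clamp t - clamp r| <= `|t - r|.
Proof.
wlog tr : t r / t <= r.
  by have [tr|/ltW rt] := leP t r; [exact|rewrite distrC (distrC t); exact].
rewrite distrC (distrC t) !ger0_norm ?subr_ge0 ?clamp_le//.
by move: tr; rewrite /clamp; case: (leP t d) => ?; case: (leP r d) => ?;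
  case: (leP 0 t) => ?; case: (leP 0 r) => ?; case: (leP 0 d) => ?; lra.
Qed.

(* Integrating up to [clamp t] makes all estimates uniform over the whole line. *)
Definition picard_map y t : 'rV[R]_n := x + \row_i
  \int[@lebesgue_measure R]_(r in `[0, clamp t]) F (y r) 0 i.

(** The Lipschitz constant is the bound [M] on the field, which makes the class stable under
    [picard_map]. *)
Definition lip y := forall r t, `|y r - y t| <= M * `|r - t|.

Let coord_le (a : 'rV[R]_n) i : `|a 0 i| <= `|a|.
Proof. exact: (rV_normr_leP a (normr_ge0 a)).1. Qed.

Let rhs_continuous y i : lip y -> continuous (fun r => F (y r) 0 i).
Proof.
move=> yM; apply: (@lipschitz_continuous _ _ (L * M)) => r s.
have -> : F (y r) 0 i - F (y s) 0 i = (F (y r) - F (y s)) 0 i by rewrite !mxE.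
apply: le_trans (coord_le _ _) _; apply: le_trans (FL _ _) _.
by rewrite -mulrA ler_wpM2l.
Qed.

Let rhs_integrable y i a b : lip y ->
  (@lebesgue_measure R).-integrable `[a, b] (EFin \o (fun r => F (y r) 0 i)).
Proof.
move=> yM; apply: continuous_compact_integrable; first exact: segment_compact.
by apply: continuous_subspaceT; exact: rhs_continuous.
Qed.

(** Keeping the clamped times on the right also bounds the distance between any two values by
    [M * d], which starts the geometric estimate of [yk_step]. *)
Lemma picard_map_dist y r t : lip y ->
  `|picard_map y r - picard_map y t| <= M * `|clamp r - clamp t|.
Proof.
move=> yM; wlog tr : r t / t <= r => [wlg|].
  have [tr|/ltW rt] := leP t r; first exact: wlg tr.
  by rewrite (distrC (picard_map y r)) (distrC (clamp r)); exact: wlg rt.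
apply/rV_normr_leP; first by rewrite mulr_ge0.
move=> i; rewrite /picard_map !mxE opprD addrACA subrr add0r.
have [/andP[t0 _] /andP[r0 _]] := (clampP t, clampP r).
have ctr := clamp_le tr.
have ig := rhs_integrable i 0 (clamp r) yM.
rewrite (Rintegral_itvB ig) ?bnd_simp//.
have mE : fine (@lebesgue_measure R `]clamp t, clamp r]%classic) = clamp r - clamp t.
  by rewrite lebesgue_measure_itv/= lte_fin; case: ltP => [//|?]/=; lra.
have -> : `|clamp r - clamp t| = clamp r - clamp t by rewrite ger0_norm// subr_ge0.
rewrite -[X in _ <= _ * X]mE; apply: norm_Rintegral_le => //.
- by rewrite lebesgue_measure_itv/=; case: ifP => // _; rewrite -EFinB ltry.
- by apply: integrableS ig => //; apply: subset_itvr; rewrite bnd_simp.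
- by move=> s _; exact: le_trans (coord_le _ _) (FM _).
Qed.

Lemma picard_map_lip y : lip y -> lip (picard_map y).
Proof. by move=> yM r t; rewrite (le_trans (picard_map_dist _ _ yM))// ler_wpM2l. Qed.

Lemma picard_map0 y : picard_map y 0 = x.
Proof.
apply/rowP => i; rewrite !mxE [clamp _]clampE ?lexx ?ltW//.
by rewrite set_itv1 Rintegral_set1 addr0.
Qed.

(** The integrands differ by at most [L * C] on an interval of length at most [d], and
    [L * d <= 1/2]. *)
Lemma picard_map_contract y z C : lip y -> lip z ->
  (forall r, `|y r - z r| <= C) ->
  forall t, `|picard_map y t - picard_map z t| <= C / 2.
Proof.
move=> yM zM yzC t.
have C0 : 0 <= C by apply: le_trans (yzC 0).
have [/andP[t0 td]] := clampP t.
apply/rV_normr_leP => [|i]; first by rewrite divr_ge0.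
rewrite /picard_map !mxE opprD addrACA subrr add0r.
have [igy igz] := (rhs_integrable i 0 (clamp t) yM, rhs_integrable i 0 (clamp t) zM).
rewrite -RintegralB//.
have mE : fine (@lebesgue_measure R `[0, clamp t]%classic) = clamp t.
  by rewrite lebesgue_measure_itv/= lte_fin; case: ltP => [//|?]/=; lra.
apply: (@le_trans _ _ (L * C * clamp t)); last first.
  apply: (@le_trans _ _ (L * d * C)).
    by rewrite [L * d * C]mulrAC ler_wpM2l// mulr_ge0.
  by rewrite mulrC ler_wpM2l.
rewrite -[X in _ <= _ * X]mE; apply: norm_Rintegral_le => //.
- by rewrite lebesgue_measure_itv/=; case: ifP => // _; rewrite -EFinB ltry.
- rewrite (_ : EFin \o _ = ((EFin \o (fun r => F (y r) 0%R i)) \-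
    (EFin \o (fun r => F (z r) 0%R i)))%E); first exact: integrableB.
  by apply/funext => s /=; rewrite EFinB.
- move=> s _; have -> : F (y s) 0 i - F (z s) 0 i = (F (y s) - F (z s)) 0 i.
    by rewrite !mxE.
  apply: le_trans (coord_le _ _) _; apply: le_trans (FL _ _) _.
  by rewrite ler_wpM2l.
Qed.

Let yk k : R -> 'rV[R]_n := iter k picard_map (fun=> x).

Let yk_lip k : lip (yk k).
Proof.
elim: k => [r t|k IHk]; last exact: picard_map_lip.
by rewrite /yk/= subrr normr0 mulr_ge0.
Qed.

Let yk_step k t : `|yk k.+1 t - yk k t| <= M * d * 2^-1 ^+ k.
Proof.
elim: k t => [|k IHk] t; last first.
  rewrite exprS mulrCA [leRHS]mulrC.
  exact: (picard_map_contract (yk_lip k.+1) (yk_lip k) IHk).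
(* The initial iterate [x] is also the value of the first iterate at time 0, so the first step is an
   increment of one curve. *)
rewrite expr0 mulr1 -[X in _ - X](picard_map0 (fun=> x)).
apply: le_trans (picard_map_dist _ _ (yk_lip 0)) _; rewrite ler_wpM2l//.
have [/andP[? ?] /andP[? ?]] := (clampP t, clampP 0).
by rewrite ler_distl; apply/andP; split; lra.
Qed.

Let yk_dist k j t : `|yk (k + j) t - yk k t| <= 2 * M * d * 2^-1 ^+ k.
Proof.
(* The factor [1 - 2^-j] comes from the partial geometric sum; with it the induction on [j]
   closes. *)
apply: (@le_trans _ _ (2 * M * d * 2^-1 ^+ k * (1 - 2^-1 ^+ j))); last first.
  apply: ler_piMr; last by rewrite gerBl exprn_ge0// invr_ge0.
  by rewrite !mulr_ge0 ?exprn_ge0 ?invr_ge0// ltW.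
elim: j => [|j IHj]; first by rewrite addn0 subrr normr0 expr0 subrr mulr0.
rewrite addnS; apply: le_trans (ler_distD (yk (k + j) t) _ _) _.
apply: le_trans (lerD (yk_step _ _) IHj) _.
by rewrite exprD exprS le_eqVlt; apply/orP; left; apply/eqP; field.
Qed.

Let yk_cvg t : cvgn (fun k => yk k t).
Proof.
apply/cauchy_cvgP/cauchy_exP => e e0.
have [k _ /(_ _ (leqnn k)) ke] := dyadic_small (2 * M * d) e0.
exists (yk k t); exists k => // j /= kj; rewrite -ball_normE/= -(subnKC kj) distrC.
exact: le_lt_trans (yk_dist _ _ _) ke.
Qed.

Let y t : 'rV[R]_n := limn (fun k => yk k t).

Let yk_lim k t : `|yk k t - y t| <= 2 * M * d * 2^-1 ^+ k.
Proof.
apply/ler_addgt0Pr => e e0.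
have /cvgrPdist_lt/(_ _ e0)[N _ /(_ (k + N)%N)] : yk j t @[j --> \oo] --> y t.
  exact: yk_cvg.
rewrite /= leq_addl => /(_ isT) yN.
apply: le_trans (ler_distD (yk (k + N) t) _ _) _.
apply: lerD; first by rewrite distrC; exact: yk_dist.
by rewrite distrC; exact: ltW.
Qed.

Let y_lip : lip y.
Proof.
move=> r t; apply: (@ler_dyadic _ _ _ (2 * M * d + 2 * M * d)) => k.
apply: le_trans (ler_distD (yk k t) _ _) _.
rewrite mulrDl addrA; apply: lerD; last exact: yk_lim.
apply: le_trans (ler_distD (yk k r) _ _) _; rewrite [leLHS]addrC.
by apply: lerD; [exact: yk_lip|rewrite distrC; exact: yk_lim].
Qed.

(** Both sides are compared with the iterate [k.+1]: the left one by convergence, the right one by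
    contraction from the iterate [k]. *)
Let y_fix t : y t = picard_map y t.
Proof.
apply/eqP; rewrite -subr_eq0 -normr_le0.
apply: (@ler_dyadic _ _ _ (2 * M * d)) => k; rewrite add0r.
apply: le_trans (ler_distD (yk k.+1 t) _ _) _; rewrite distrC.
apply: le_trans (lerD (yk_lim k.+1 t)
  (picard_map_contract (yk_lip k) y_lip (yk_lim k) t)) _.
by rewrite exprS le_eqVlt; apply/orP; left; apply/eqP; field.
Qed.

(** Strictly inside the interval the clamp is locally the identity, so the fixed-point equation is
    an integral equation and the fundamental theorem of calculus applies to each coordinate. *)
Let y_derive t : 0 < t < d -> is_derive t 1 y (F (y t)).
Proof.
move=> /andP[t0 td].
have near_y : \near t,
    x + \row_i \int[@lebesgue_measure R]_(r in `[0, t]) F (y r) 0 i = y t.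
  near=> s; rewrite y_fix /picard_map clampE//; apply/andP; split; apply/ltW.
    by near: s; exact: lt_nbhsr.
  by near: s; exact: lt_nbhsl.
apply: near_eq_is_derive near_y _.
have FTC i := continuous_FTC1_closed td (rhs_integrable i 0 d y_lip) t0
  (@rhs_continuous y i y_lip t).
pose G t i j := x i j + \int[@lebesgue_measure R]_(r in `[0, t]) F (y r) 0 j.
have GE : (fun t => x + \row_i \int[@lebesgue_measure R]_(r in `[0, t]) F (y r) 0 i) =
    (fun t => \matrix_(i, j) G t i j).
  by apply/funext => s; apply/matrixP => i j; rewrite !mxE /G.
have dG i j : is_derive t 1 (fun s => G s i j) (F (y t) 0 j).
  have [dj ej] := FTC j; rewrite /G -[F _ _ _]add0r; apply: is_deriveD.
  by apply: DeriveDef; [exact: dj|rewrite -derive1E; exact: ej].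
have dGm : derivable (fun t => \matrix_(i, j) G t i j : 'rV[R]_n) t 1.
  apply/derivable_mxP => i j; under eq_fun do rewrite mxE.
  by have [] := dG i j.
rewrite GE; apply: DeriveDef => //; rewrite derive_mx//; apply/matrixP => i j.
by rewrite mxE (ord1 i); under eq_fun do rewrite mxE; have [] := dG 0 j.
Unshelve. all: by end_near. Qed.

Lemma picard_local : exists y : R -> 'rV[R]_n, [/\ y 0 = x,
  (forall r t, `|y r - y t| <= M * `|r - t|) &
  (forall t, 0 < t < d -> is_derive t 1 y (F (y t)))].
Proof. by exists y; split => //; rewrite y_fix picard_map0. Qed.

End picard.

Lemma lipschitz_abs_continuous (R : realType) (n : nat) (K a b : R)
    (y : R -> 'rV[R]_n) : 0 <= K -> (forall r s, `|y r - y s| <= K * `|r - s|) ->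
  abs_continuous_on a b y.
Proof.
(* The factor [n] compares [enorm] with the max-norm; the added 1 keeps the denominator positive
   when [n * K = 0]. *)
move=> K0 yK e e0; have nK0 : 0 < n%:R * K + 1 by rewrite ltr_pwDr// mulr_ge0.
exists (e / (n%:R * K + 1)); first by rewrite divr_gt0.
move=> N s t st _; rewrite ltr_pdivlMr// => ste.
apply: le_lt_trans ste; rewrite mulr_suml; apply: ler_sum => i _.
have [_ [sti _]] := st i.
apply: le_trans (enorm_le_normr _) _.
apply: (@le_trans _ _ (n%:R * (K * `|t i - s i|))); first by rewrite ler_wpM2l.
have sti0 : 0 <= t i - s i by lra.
by rewrite ger0_norm// mulrA [leRHS]mulrC ler_wpM2r// lerDl.
Qed.

(** * From short intervals to arbitrary horizons *)

Section existence.
Context (R : realType) (n m : nat) (T : R) (U : set 'rV[R]_m).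
Context (f : 'rV[R]_n -> 'rV[R]_m -> 'rV[R]_n) (h : R -> 'rV[R]_n -> 'rV[R]_m -> R).
Hypothesis HA : standing_assumptions T U f h.

(** The length [d] depends on the Lipschitz constant and not on [x], so finitely many pieces reach
    any horizon. *)
Lemma trajectory_cst_local (u0 : 'rV[R]_m) : U u0 -> exists2 d : R, 0 < d &
  forall x, exists y, trajectory f d x (fun=> u0) y.
Proof.
move=> Uu0.
have [Lf Lf0 fL] := dynamics_lipschitz HA; have [Mf Mf0 fM] := dynamics_bounded HA.
(* The factor [n] converts the Euclidean Lipschitz constant into one for the max-norm. *)
pose L := Lf * n%:R; have L0 : 0 <= L by rewrite mulr_ge0// ltW.
pose d := (2 * (L + 1))^-1.
have d0 : 0 < d by rewrite invr_gt0 mulr_gt0// ltr_pwDr.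
have Ld : L * d <= 2^-1.
  rewrite /d invfM mulrCA ler_piMr ?invr_ge0// ler_pdivrMr ?ltr_pwDr// mul1r lerDl//.
exists d => // x.
have FL a b : `|f a u0 - f b u0| <= L * `|a - b|.
  apply: le_trans (normr_le_enorm _) _; apply: le_trans (fL _ _ _ Uu0) _.
  by rewrite /L -mulrA ler_wpM2l ?(ltW Lf0)// enorm_le_normr.
have FM a : `|f a u0| <= Mf by apply: le_trans (normr_le_enorm _) (fM _ _ Uu0).
have [y [y0 yM dy]] := picard_local x L0 (ltW Mf0) d0 Ld FL FM.
exists y; split => //; first exact: lipschitz_abs_continuous (ltW Mf0) yM.
(* The derivative is known strictly between 0 and [d]; the two endpoints are discarded as null. *)
move: (ae_neq (0 : R)) (ae_neq d); apply: filterS2.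
  exact: (ae_filter_ringOfSetsType (@lebesgue_measure R)).
move=> r r0 rd /andP[r0' rd']; apply: dy.
by rewrite !lt_neqAle r0' rd' rd eq_sym r0.
Qed.

Lemma trajectory_exists s x : exists u y,
  admissible_control U s u /\ trajectory f s x u y.
Proof.
have [u0 Uu0] := control_set_nonempty HA.
have [d d0 local] := trajectory_cst_local Uu0.
suff [y ytr] : exists y, trajectory f s x (fun=> u0) y.
  by exists (fun=> u0), y; split => //; split => //; exact: measurable_cst.
(* The starting point stays general, because the remaining pieces restart at [y1 d]. *)
have multiples k : forall z, exists y, trajectory f (k%:R * d) z (fun=> u0) y.
  elim: k => [|k IHk] z.
    by have [y ytr] := local z; exists y; apply: trajectoryS ytr; rewrite mul0r ltW.
  have [y1 y1tr] := local z; have [y2 y2tr] := IHk (y1 d).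
  exists (concat d y1 y2); rewrite -natr1 mulrDl mul1r addrC.
  have -> : (fun=> u0) = concat d (fun=> u0) (fun=> u0).
    by apply/funext => r; rewrite /concat if_same.
  by apply: trajectory_concat => //; [exact: ltW|rewrite mulr_ge0// ltW].
have [y ytr] := multiples (Num.truncn (s / d)).+1 x; exists y.
apply: trajectoryS ytr; rewrite -ler_pdivrMr//.
by rewrite ltW// truncnS_gt.
Qed.

End existence.

(** * Dynamic programming *)

Lemma norm_inf_le (R : realType) (S : set R) (M : R) : S !=set0 ->
  (forall r, S r -> `|r| <= M) -> `|inf S| <= M.
Proof.
move=> [r Sr] SM; have SNM : lbound S (- M).
  by move=> s /SM; rewrite ler_norml => /andP[].
rewrite ler_norml lb_le_inf//=; last by exists r.
apply: le_trans (le_trans (ler_norm r) (SM r Sr)).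
by apply: ge_inf => //; exists (- M).
Qed.

Section dynamic_programming.
Context (R : realType) (n m : nat) (T lam sigma : R) (U : set 'rV[R]_m).
Context (f : 'rV[R]_n -> 'rV[R]_m -> 'rV[R]_n) (h : R -> 'rV[R]_n -> 'rV[R]_m -> R).
Hypotheses (lam_gt0 : 0 < lam) (sigma_gt0 : 0 < sigma).
Hypothesis HA : standing_assumptions T U f h.
Implicit Types (p : R * 'rV[R]_n) (Psi : R * 'rV[R]_n -> R).

Local Notation gamma := (expR (- (lam * sigma))).
Local Notation W := (value_function T U f h lam).
Local Notation TB := (bellman T U f h sigma lam).

Lemma value_function_bounded : bounded_on (slab `[0, T]) W.
Proof.
have [M hM] := running_cost_bound lam_gt0 HA; exists M => -[t x].
rewrite /slab/= in_itv/= => /andP[t0 tT]; apply: norm_inf_le.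
  by have [u [y [uad ytr]]] := trajectory_exists HA t x; eexists; exists u, y; split.
by move=> _ [u [y [uad ytr ->]]]; exact: hM uad ytr.
Qed.

Lemma value_function_le t x u y : 0 <= t <= T ->
  admissible_control U t u -> trajectory f t x u y ->
  W (t, x) <= running_cost h T lam t t y u.
Proof.
move=> /andP[t0 tT] uad ytr; have [M hM] := running_cost_bound lam_gt0 HA.
apply: ge_inf; last by exists u, y.
exists (- M) => _ [v [z [vad ztr ->]]].
by have := hM _ _ _ _ _ t0 (lexx _) tT vad ztr; rewrite ler_norml => /andP[].
Qed.

Lemma bellman_set_bound p Psi : sigma <= p.1 <= T -> bounded_on (slab `[0, T]) Psi ->
  exists M, forall a y, admissible_control U sigma a -> trajectory f sigma p.2 a y ->
  - M <= running_cost h T lam sigma p.1 y a + gamma * Psi (p.1 - sigma, y sigma).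
Proof.
move=> /andP[sp pT] [N hN]; have [M hM] := running_cost_bound lam_gt0 HA.
exists (M + gamma * N) => a y aad ytr; rewrite opprD lerD//.
  by have := hM _ _ _ _ _ (ltW sigma_gt0) sp pT aad ytr; rewrite ler_norml => /andP[].
rewrite -mulrN ler_wpM2l ?expR_ge0//.
have : `|Psi (p.1 - sigma, y sigma)| <= N.
  by apply: hN; rewrite /slab/= in_itv/=; apply/andP; split; have := sigma_gt0; lra.
by rewrite ler_norml => /andP[].
Qed.

Lemma bellman_value_function p : sigma <= p.1 <= T -> TB W p = W p.
Proof.
move=> /[dup] pI /andP[sp pT]; have s0 := ltW sigma_gt0.
have [M hM] := bellman_set_bound pI value_function_bounded.
have l0 : 0 <= p.1 - sigma by lra.
have lT : 0 <= p.1 - sigma <= T by rewrite l0/=; lra.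
have sl : sigma + (p.1 - sigma) = p.1 by rewrite addrC subrK.
apply/eqP; rewrite eq_le; apply/andP; split.
  (* [TB W p <= W p]: any control on the whole horizon is cut at [sigma], and the cost of its tail
     is at least [W] there. *)
  apply: lb_le_inf.
    by have [u [y [uad ytr]]] := trajectory_exists HA p.1 p.2; eexists;
      exists u, y; split.
  move=> _ [u [y [uad ytr ->]]].
  have uad1 := admissible_controlS sp uad; have ytr1 := trajectoryS sp ytr.
  rewrite (running_cost_split lam_gt0 HA s0 l0 sl pT uad ytr).
  apply: (@le_trans _ _ (running_cost h T lam sigma p.1 y u +
                          gamma * W (p.1 - sigma, y sigma))).
    apply: ge_inf; last by exists u, y.
    by exists (- M) => _ [v [z [vad ztr ->]]]; exact: hM.
  rewrite lerD2l ler_wpM2l ?expR_ge0//; apply: value_function_le => //.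
    by apply: admissible_control_addl; rewrite ?sl.
  by apply: (@trajectory_addl _ _ _ f _ _ p.2 u y s0); rewrite sl.
(* [W p <= TB W p]: any initial piece is continued by an arbitrary control from the point it
   reaches. *)
apply: lb_le_inf.
  by have [u [y [uad ytr]]] := trajectory_exists HA sigma p.2; eexists;
    exists u, y; split.
move=> _ [a [y1 [aad ytr1 ->]]].
(* Isolating the inner [W] turns the goal into a lower bound on the costs of all tails, so no
   near-optimal control has to be chosen. *)
rewrite -lerBlDl -ler_pdivrMl ?expR_gt0//; apply: lb_le_inf.
  have [u [y [uad ytr]]] := trajectory_exists HA (p.1 - sigma) (y1 sigma).
  by eexists; exists u, y; split.
move=> _ [u2 [y2 [uad2 ytr2 ->]]].
rewrite ler_pdivrMl ?expR_gt0// lerBlDl.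
have uad := admissible_control_concat s0 l0 aad uad2.
have ytr := trajectory_concat s0 l0 ytr1 ytr2.
have uadr := admissible_control_addl s0 uad; have ytrr := trajectory_addl s0 ytr.
rewrite sl in uad ytr.
have pT' : 0 <= p.1 <= T by rewrite pT andbT; lra.
rewrite [X in W X]surjective_pairing.
apply: le_trans (value_function_le pT' uad ytr) _.
rewrite (running_cost_split lam_gt0 HA s0 l0 sl pT uad ytr) le_eqVlt.
(* The glued pair agrees with [(a, y1)] before [sigma] and, once shifted, with [(u2, y2)] after
   it. *)
apply/orP; left; apply/eqP; congr (_ + _ * _).
  apply: (running_cost_eq lam_gt0 HA s0 sp pT (admissible_controlS sp uad)
    (trajectoryS sp ytr) aad ytr1).
  by move=> r /andP[_ rs]; rewrite /concat rs.
have [_ lT'] := andP lT.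
apply: (running_cost_eq lam_gt0 HA l0 (lexx _) lT' uadr ytrr uad2 ytr2).
move=> r /andP[r0 _]; rewrite /concat.
have -> : (sigma + r < sigma) = false by apply/negbTE; rewrite -leNgt lerDl ltW.
by rewrite addrAC subrr add0r.
Qed.

(** For a fixed trajectory the running costs cancel, leaving [gamma] times the difference of the two
    functions at time [p.1 - sigma], which lies in [[0, T]]. *)
Lemma bellman_dist Psi1 Psi2 (d : R) p :
  bounded_on (slab `[0, T]) Psi1 -> bounded_on (slab `[0, T]) Psi2 ->
  (forall q, slab `[0, T] q -> `|Psi1 q - Psi2 q| <= d) -> sigma <= p.1 <= T ->
  `|TB Psi1 p - TB Psi2 p| <= gamma * d.
Proof.
move=> bPsi1 bPsi2 Psi12 /[dup] pI /andP[sp pT].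
(* Both Bellman values become infima over one common set of pairs, as [ler_dist_inf] requires. *)
pose P (c : (R -> 'rV[R]_m) * (R -> 'rV[R]_n)) :=
  admissible_control U sigma c.1 /\ trajectory f sigma p.2 c.1 c.2.
pose J Psi (c : (R -> 'rV[R]_m) * (R -> 'rV[R]_n)) :=
  running_cost h T lam sigma p.1 c.2 c.1 + gamma * Psi (p.1 - sigma, c.2 sigma).
have JE Psi : TB Psi p = inf (J Psi @` P).
  congr inf; apply/seteqP; split => r.
    by move=> [a [y [aad ytr ->]]]; exists (a, y).
  by move=> [[a y] [aad ytr] <-]; exists a, y.
have lbJ Psi : bounded_on (slab `[0, T]) Psi -> has_lbound (J Psi @` P).
  move=> /(bellman_set_bound pI)[M hM]; exists (- M) => _ [[a y] [aad ytr] <-].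
  exact: hM.
have slab_p (x : 'rV[R]_n) : slab `[0, T] (p.1 - sigma, x).
  by rewrite /slab/= in_itv/=; apply/andP; split; have := sigma_gt0; lra.
rewrite !JE; apply: ler_dist_inf; [|exact: lbJ|exact: lbJ|].
  by rewrite mulr_ge0 ?expR_ge0// (le_trans (normr_ge0 _) (Psi12 _ (slab_p 0))).
move=> [a y] _; rewrite /J/= opprD addrACA subrr add0r -mulrBr normrM.
by rewrite ger0_norm ?expR_ge0// ler_wpM2l ?expR_ge0// Psi12.
Qed.

End dynamic_programming.

(* (T_{sigma,lam} Psi)(tau, .) reads Psi at time tau - sigma in [0, T - sigma].
   Hence the right-hand norm in the contraction estimate is over the whole
   domain [0, T] x R^n, and the residual estimate needs the error bound on the
   initial layer [0, sigma) x R^n: with norms over [sigma, T] x R^n only, both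
   claims fail (already for f = 0, h = 0, sigma = T). *)
Theorem lemma3 (R : realType) (n m : nat) (T lam sigma : R)
    (U : set 'rV[R]_m) (f : 'rV[R]_n -> 'rV[R]_m -> 'rV[R]_n)
    (h : R -> 'rV[R]_n -> 'rV[R]_m -> R)
    (T_gt0 : 0 < T) (lam_gt0 : 0 < lam) (sigma_gt0 : 0 < sigma)
    (sigma_le_T : sigma <= T)
    (HA : standing_assumptions T U f h) :
  let gamma := expR (- (lam * sigma)) in
  let TB := bellman T U f h sigma lam in
  let W := value_function T U f h lam in
  (forall Psi1 Psi2 : R * 'rV[R]_n -> R,
     bounded_on (slab `[0, T]) Psi1 -> bounded_on (slab `[0, T]) Psi2 ->
     (supnorm (slab `[sigma, T]) (TB Psi1 \- TB Psi2)%R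
        <= gamma%:E * supnorm (slab `[0, T]%R) (Psi1 \- Psi2)%R)%E)
  /\
  (forall (What : R * 'rV[R]_n -> R) (vs : R),
     bounded_on (slab `[0, T]) What ->
     0 <= vs ->
     (supnorm (slab `[sigma, T]) (TB What \- What)%R <= vs%:E)%E ->
     (supnorm (slab `[0, sigma[%R) (What \- W)%R <= ((vs / (1 - gamma))%R)%:E)%E ->
     (supnorm (slab `[sigma, T]) (What \- W)%R <= ((vs / (1 - gamma))%R)%:E)%E).

Proof.
move=> gamma TB W; have s0 := ltW sigma_gt0.
have slab0 : slab `[0, T] (0, 0 : 'rV[R]_n) by rewrite /slab/= in_itv/= lexx ltW.
split=> [Psi1 Psi2 bPsi1 bPsi2|What vs bWhat vs0 res init].
  have [|d dE] := @supnorm_EFin _ _ (slab `[0, T]) (Psi1 \- Psi2) (ex_intro _ _ slab0).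
    have [[M1 hM1] [M2 hM2]] := (bPsi1, bPsi2); exists (M1 + M2) => p pT /=.
    by apply: le_trans (ler_normB _ _) _; rewrite lerD ?hM1 ?hM2.
  rewrite dE -EFinM; apply/supnorm_leP => p; rewrite /slab/= in_itv/= => pI.
  by apply: (bellman_dist lam_gt0 sigma_gt0 HA) => //; apply/supnorm_leP; rewrite dE.
have gamma_lt1 : gamma < 1 by rewrite -expR0 ltr_expR oppr_lt0 mulr_gt0.
have bW : bounded_on (slab `[0, T]) W by exact: value_function_bounded.
set B := vs / (1 - gamma) in init *.
have slabT : slab `[sigma, T] (T, 0 : 'rV[R]_n).
  by rewrite /slab/= in_itv/= lexx sigma_le_T.
have [|d dE] := @supnorm_EFin _ _ (slab `[sigma, T]) (What \- W) (ex_intro _ _ slabT).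
  have [[M1 hM1] [M2 hM2]] := (bWhat, bW); exists (M1 + M2) => p pT /=.
  apply: le_trans (ler_normB _ _) _; apply: lerD; [apply: hM1|apply: hM2];
    move: pT; rewrite /slab/= !in_itv/= => /andP[? ->]; rewrite andbT; lra.
rewrite dE lee_fin leNgt; apply/negP => Bd.
(* [d] bounds the error on the whole of [[0, T]], as [B < d]. *)
have dW q : slab `[0, T] q -> `|What q - W q| <= d.
  rewrite /slab/= in_itv/= => /andP[q0 qT]; have [qs|sq] := ltP q.1 sigma.
    have /supnorm_leP/(_ q) := init; rewrite /slab/= in_itv/= q0 qs => /(_ isT).
    by move=> /le_trans; apply; exact: ltW.
  have : (supnorm (slab `[sigma, T]) (What \- W)%R <= d%:E)%E by rewrite dE.
  by move=> /supnorm_leP/(_ q); rewrite /slab/= in_itv/= sq qT; exact.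
(* As [vs = B * (1 - gamma)], this inequality gives [d <= B], against [B < d]. *)
suff : d <= vs + gamma * d.
  have -> : vs = B * (1 - gamma) by rewrite /B divfK// subr_eq0 gt_eqF.
  have : 0 < 1 - gamma by rewrite subr_gt0.
  by nra.
rewrite -lee_fin -dE; apply/supnorm_leP => p pI /=.
have pI' : sigma <= p.1 <= T by move: pI; rewrite /slab/= in_itv/=.
(* Through [TB What p], the error splits into the residual and a difference of Bellman images, [W p]
   being [TB W p]. *)
apply: le_trans (ler_distD (TB What p) _ _) _; apply: lerD.
  by rewrite distrC; move/supnorm_leP : res; exact.
rewrite -[W p](bellman_value_function lam_gt0 sigma_gt0 HA pI').
exact: (bellman_dist lam_gt0 sigma_gt0 HA bWhat bW dW pI').
Qed.
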